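(* Let $\pi^{*}$ be a (nonnegative) Borel measure on $\mathbb{R}^d$ with $0<M:=\pi^{*}(\mathbb{R}^d)<\infty$, and let $\pi:=\pi^{*}/M$. Let $p\ge 1$, let $\hat\pi$ be a probability distribution on $\mathbb{R}^d$ with $\pi\ll\hat\pi$, and let $\eta$ be any probability distribution on $\mathbb{R}^d$ with $\pi\ll\eta$. Then $$W_p(\hat\pi,\pi)\le C^{\mathrm{PI}}_{2p}(\hat\pi)\,\big[\exp\{\mathrm{H}_2(\hat\pi,\eta)\}-1\big]^{\frac{1}{2p}}$$ and $$W_p(\hat\pi,\pi)\le C^{\mathrm{EI}}_{p}(\hat\pi)\Big[\mathrm{H}_2(\hat\pi,\eta)^{\frac1p}+\{\mathrm{H}_2(\hat\pi,\eta)/2\}^{\frac{1}{2p}}\Big].$$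
   Context: All distributions are Borel probability measures on $\mathbb{R}^d$; $\mu\ll\nu$ denotes absolute continuity. Quantities take values in $[-\infty,\infty]$, with the convention $0\cdot\infty=0$. Wasserstein distance: $W_p(\xi,\pi)=\inf_{\gamma}\{\int\|\theta-\theta'\|_2^p\,\gamma(d\theta,d\theta')\}^{1/p}$, the infimum being over couplings $\gamma$ of $\xi$ and $\pi$. Moment constants: for $r\ge1$, $C^{\mathrm{PI}}_{r}(\xi)=2\inf_{\theta_0\in\mathbb{R}^d}\{\int\|\theta-\theta_0\|_2^{r}\,\xi(d\theta)\}^{1/r}$ and $C^{\mathrm{EI}}_{r}(\xi)=2\inf_{\theta_0\in\mathbb{R}^d,\,\epsilon>0}\big[\frac1\epsilon\{\frac32+\log\int e^{\epsilon\|\theta-\theta_0\|_2^{r}}\xi(d\theta)\}\big]^{1/r}$. Rényi divergence: for $\alpha>1$ and $\pi\ll\xi$, $D_\alpha(\pi\mid\xi)=\frac1{\alpha-1}\log\int\big(\frac{d\pi}{d\xi}\big)^{\alpha-1}d\pi$. Variational objectives: $\mathsf{ELBO}(\eta)=\int\log\big(\frac{d\pi^{*}}{d\eta}\big)d\eta$ (with $\log 0=-\infty$), and for $\alpha>1$, $\mathsf{CUBO}_\alpha(\xi)=(1-\alpha^{-1})D_\alpha(\pi\mid\xi)+\log M=\log\{\int(\frac{d\pi^{*}}{d\xi})^{\alpha}d\xi\}^{1/\alpha}$. For $\alpha>1$, $\mathrm{H}_\alpha(\xi,\eta)=\frac{\alpha}{\alpha-1}\{\mathsf{CUBO}_\alpha(\xi)-\mathsf{ELBO}(\eta)\}$.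 *)

(* Defs.v *)
From HB Require Import structures.
From mathcomp Require Import all_boot all_order all_algebra.
From mathcomp Require Import all_classical all_reals all_analysis.

Set Implicit Arguments.
Unset Strict Implicit.
Unset Printing Implicit Defensive.

Import Order.TTheory GRing.Theory Num.Theory numFieldNormedType.Exports.

Local Open Scope classical_set_scope.
Local Open Scope ring_scope.

(* R^d with its Borel sigma-algebra, generated by the open sets of the usual
   topology. *)
Notation Rd R d := (g_sigma_algebraType (@open 'rV[R]_d)).

(* The library's norm on 'rV[R]_d is the sup norm, hence this definition. *)
Definition norm2 (R : realType) (d : nat) (x : 'rV[R]_d) : R :=
  Num.sqrt (\sum_(i < d) x ord0 i ^+ 2).

Definition dist2 (R : realType) (d : nat) (x y : Rd R d) : R :=
  norm2 ((x : 'rV[R]_d) - (y : 'rV[R]_d)).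

Local Open Scope ereal_scope.
Local Open Scope charge_scope.

Definition coupling (R : realType) (d : nat) (xi pi : probability (Rd R d) R)
    (gamma : probability (Rd R d * Rd R d)%type R) : Prop :=
  forall A : set (Rd R d), measurable A ->
    gamma (A `*` setT) = xi A /\ gamma (setT `*` A) = pi A.

Definition wasserstein (R : realType) (d : nat) (p : R)
    (xi pi : probability (Rd R d) R) : \bar R :=
  ereal_inf [set (\int[gamma]_z ((dist2 z.1 z.2) `^ p)%:E) `^ p^-1
            | gamma in [set gamma | coupling xi pi gamma]].

Definition C_PI (R : realType) (d : nat) (r : R)
    (xi : probability (Rd R d) R) : \bar R :=
  2%:E * ereal_inf [set (\int[xi]_x ((dist2 x x0) `^ r)%:E) `^ r^-1
                   | x0 in [set: Rd R d]].

Definition C_EI (R : realType) (d : nat) (r : R)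
    (xi : probability (Rd R d) R) : \bar R :=
  2%:E * ereal_inf
    [set ((eps^-1)%:E *
          ((3 / 2)%:E +
           lne (\int[xi]_x (expR (eps * (dist2 x x0) `^ r))%:E))) `^ r^-1
    | x0 in [set: Rd R d] & eps in [set eps : R | (0 < eps)%R]].

(* Density of mu with respect to xi; the library's Radon-Nikodym derivative is
   stated for signed measures (charges), and is meaningful when mu `<< xi. *)
Definition density (R : realType) (d : nat)
    (mu : {finite_measure set (Rd R d) -> \bar R})
    (xi : probability (Rd R d) R) : Rd R d -> \bar R :=
  'd (charge_of_finite_measure mu) '/d xi.

Definition renyi (R : realType) (d : nat) (alpha : R)
    (pi xi : probability (Rd R d) R) : \bar R :=
  ((alpha - 1)^-1)%:E *
    lne (\int[pi]_x (density pi xi x) `^ (alpha - 1)).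

(* The probability pi = pi^* / M; the Dirac mass is only a default value, used
   when M = 0 (excluded in the theorem). *)
Definition normalized (R : realType) (d : nat)
    (pistar : {finite_measure set (Rd R d) -> \bar R}) :
    probability (Rd R d) R :=
  mnormalize pistar (dirac ((0%R : 'rV[R]_d) : Rd R d) : probability (Rd R d) R).

(* lne 0 = -oo *)
Definition ELBO (R : realType) (d : nat)
    (pistar : {finite_measure set (Rd R d) -> \bar R})
    (eta : probability (Rd R d) R) : \bar R :=
  \int[eta]_x lne (density pistar eta x).

Definition CUBO (R : realType) (d : nat) (alpha : R)
    (pistar : {finite_measure set (Rd R d) -> \bar R})
    (xi : probability (Rd R d) R) : \bar R :=
  (1 - alpha^-1)%:E * renyi alpha (normalized pistar) xi + lne (pistar setT).

Definition H_bound (R : realType) (d : nat) (alpha : R)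
    (pistar : {finite_measure set (Rd R d) -> \bar R})
    (xi eta : probability (Rd R d) R) : \bar R :=
  (alpha / (alpha - 1))%:E * (CUBO alpha pistar xi - ELBO pistar eta).

(* Main.v *)
(* Let f be the density of pi with respect to pihat and S the integral of f^2
   against pihat, so that D_2(pi | pihat) = log S. Since log x <= x - 1, the
   ELBO is at most log M, hence log S <= H_2.

   Leaving the common mass in place and coupling the remainders independently
   gives, for every centre y, W_p^p <= 2^(p-1) int |x - y|^p |f - 1| dpihat.
   Cauchy-Schwarz bounds the right-hand side by the 2p-th moment times
   (S - 1)^(1/2), which is the first inequality.

   For the second, put h = eps |x - y|^p, L = log int e^h dpihat and K = H_2.
   Then int h |f - 1| dpihat <= (3/2 + L) (sqrt (2 K) + 2 K): for K <= 1/2 by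
   Cauchy-Schwarz and int h^2 <= (L + 3/2)^2, for K >= 1/2 from
   int h f <= log S + L and int h <= L.

   When the moment constant vanishes, pihat is a Dirac mass and W_p = 0, which
   matters if H_2 is infinite. *)
Require Import Defs.
From HB Require Import structures.
From mathcomp Require Import all_boot all_order all_algebra.
From mathcomp Require Import all_classical all_reals all_analysis.
From mathcomp Require Import interval_inference measurable_realfun.
From mathcomp Require Import ring lra.
Set Implicit Arguments.
Unset Strict Implicit.
Unset Printing Implicit Defensive.

Import Order.TTheory GRing.Theory Num.Theory numFieldNormedType.Exports.
Local Open Scope classical_set_scope.
Local Open Scope ring_scope.
Local Open Scope ereal_scope.

(** * Real inequalities and the Euclidean distance *)

(** Convexity of the power [p] at the midpoint of [a] and [b], multiplied through by [2 ^ p]. *)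
Lemma powRD_le (R : realType) (p a b : R) : (1 <= p -> 0 <= a -> 0 <= b ->
  (a + b) `^ p <= 2 `^ (p - 1) * (a `^ p + b `^ p))%R.
Proof.
move=> p1 a0 b0.
have h0 : (0 <= 2^-1 :> R)%R by lra.
have h1 : (2^-1 <= 1 :> R)%R by lra.
have : ((2^-1 * a + (1 - 2^-1) * b) `^ p <=
    2^-1 * a `^ p + (1 - 2^-1) * b `^ p)%R.
  by apply: (convex_powR p1 (Itv01 h0 h1)); rewrite inE/= in_itv/= ?a0 ?b0.
have -> : (1 - 2^-1 = 2^-1 :> R)%R by lra.
rewrite -!mulrDr powRM ?invr_ge0 ?addr_ge0// => H.
have p0 : (0 < 2 `^ p :> R)%R by rewrite powR_gt0.
have -> : (2 `^ (p - 1) = 2 `^ p / 2 :> R)%R.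
  rewrite powRB ?powRr1 ?ler0n// ?pnatr_eq0 ?implybT//.
rewrite -mulrA; apply: le_trans (ler_wpM2l (ltW p0) H).
rewrite mulrA -powRM ?invr_ge0 ?ler0n//.
by rewrite divff ?pnatr_eq0// powR1 mul1r.
Qed.

(** Each fraction [c / (a + b)], for [c = a] and [c = b], lies in [0, 1], so raising it to a power
    [q <= 1] does not decrease it; the two fractions add up to one. *)
Lemma powR_subadd (R : realType) (q a b : R) : (0 < q -> q <= 1 ->
  0 <= a -> 0 <= b -> (a + b) `^ q <= a `^ q + b `^ q)%R.
Proof.
move=> q0 q1 a0 b0.
have [ab0|ab0] := eqVneq (a + b)%R 0%R.
  by rewrite ab0 powR0 ?gt_eqF// addr_ge0 ?powR_ge0.
have s0 : (0 < a + b)%R by rewrite lt_neqAle eq_sym ab0 addr_ge0.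
have key c : (0 <= c -> c <= a + b ->
    c / (a + b) * (a + b) `^ q <= c `^ q)%R.
  move=> c0 cab.
  have t0 : (0 <= c / (a + b))%R by rewrite divr_ge0// ltW.
  have -> : (c `^ q = (c / (a + b)) `^ q * (a + b) `^ q)%R.
    by rewrite -powRM ?divfK// ltW.
  rewrite ler_wpM2r ?powR_ge0//.
  have [->|c_neq0] := eqVneq c 0%R; first by rewrite mul0r powR_ge0.
  have t1 : (c / (a + b) <= 1)%R by rewrite ler_pdivrMr// mul1r.
  have tp : (0 < c / (a + b))%R by rewrite divr_gt0// lt_neqAle eq_sym c_neq0.
  by rewrite ger1_powR// tp.
have -> : ((a + b) `^ q = a / (a + b) * (a + b) `^ q + b / (a + b) * (a + b) `^ q)%R.
  by rewrite -mulrDl -mulrDl divff// mul1r.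
by rewrite lerD// key// ?lerDl ?lerDr.
Qed.

(** Made to be integrated when [expR (h - L)] has mean one: the last term then vanishes and the
    second moment of [h] is at most [(L + 3 / 2) ^ 2]. *)
Lemma ler_sqr_expR (R : realType) (L h : R) : (0 <= L -> 0 <= h ->
  h ^+ 2 <= (L + 3 / 2) ^+ 2 + (2 * L + 2) * (expR (h - L) - 1))%R.
Proof.
move=> L0 h0; set s := (h - L)%R.
have -> : h = (L + s)%R by rewrite /s; ring.
have sL : (- L <= s)%R by rewrite /s; lra.
have e1 : (1 + s <= expR s)%R := expR_ge1Dx s.
have epos : (0 < expR s)%R := expR_gt0 s.
have [s0|s0] := leP 0%R s.
  (* Together [e1] and [e2] give [(2 L + 2) (exp s - 1) >= 2 L s + s ^ 2]. *)
  have e2 : (1 + s ^+ 2 / 2 <= expR s)%R := expR_ge1Dxn 1 s0.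
  nra.
(* For [-1 <= s < 0], use [exp s - 1 >= s] and [s ^ 2 - 2 s <= - 3 s <= 3 L]. For [s < -1], use
   [exp s > 0] and [(L + s) ^ 2 <= (L + 1/2) ^ 2 = (L + 3/2) ^ 2 - (2 L + 2)]. *)
nra.
Qed.

Lemma mulr_density_le (R : realType) (S L h f : R) : (0 < S -> 0 <= f ->
  h * f <= (ln S + L - 2) * f + (f ^+ 2 / S + expR (h - L)))%R.
Proof.
move=> S0 f0; (* Young's inequality for [f * exp (h / 2 - c)], after [1 + t <= exp t] *)
set c := ((ln S + L) / 2)%R.
set E := expR (h / 2 - c).
have HE : (1 + (h / 2 - c) <= E)%R := expR_ge1Dx _.
have E2 : (E ^+ 2 = expR (h - L) / S)%R.
  rewrite /E -expRM_natl.
  have -> : (2%:R * (h / 2 - c) = (h - L) - ln S)%R by rewrite /c; lra.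
  by rewrite expRB lnK// posrE.
have -> : (expR (h - L) = S * E ^+ 2)%R by rewrite E2 mulrC divfK// gt_eqF.
have Y : (2 * f * E <= f ^+ 2 / S + S * E ^+ 2)%R.
  have -> : (f ^+ 2 / S + S * E ^+ 2 = 2 * f * E + S * (f / S - E) ^+ 2)%R.
    by field; rewrite gt_eqF.
  by rewrite lerDl mulr_ge0 ?sqr_ge0// ltW.
have -> : (ln S + L = 2 * c)%R by rewrite /c; lra.
nra.
Qed.

(** From [(1 - K) exp K <= 1] follows [exp K - 1 <= K / (1 - K)], and here [1 - K >= 1/2]. *)
Lemma expR_sub1_le2 (R : realType) (K : R) :
  (0 <= K -> K <= 1 / 2 -> expR K - 1 <= 2 * K)%R.
Proof.
move=> K0 K1; have := @expR_ge1Dx R (- K); rewrite expRN => H.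
have e0 := @expR_gt0 R K.
have : ((1 - K) * expR K <= 1)%R by rewrite -ler_pdivlMr// mul1r.
nra.
Qed.

(** The sum of the squares [(A b_i - C a_i) ^ 2] is nonnegative and equals [A (A B - C ^ 2)]; if
    [A = 0], every [a_i] is zero. *)
Lemma sum_CauchySchwarz (R : realType) (n : nat) (a b : 'I_n -> R) :
  ((\sum_i a i * b i) ^+ 2 <= (\sum_i a i ^+ 2) * (\sum_i b i ^+ 2))%R.
Proof.
set A := (\sum_i a i ^+ 2)%R; set B := (\sum_i b i ^+ 2)%R.
set C := (\sum_i a i * b i)%R.
have A0 : (0 <= A)%R by apply: sumr_ge0 => i _; exact: sqr_ge0.
have [/eqP|An0] := eqVneq A 0%R.
  rewrite /A psumr_eq0; last by move=> i _; exact: sqr_ge0.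
  move=> /allP a0; rewrite /C big1 ?expr0n ?mulr_ge0// ?sumr_ge0//.
    by move=> i _; exact: sqr_ge0.
  move=> i _; have := a0 i (mem_index_enum _); rewrite /= sqrf_eq0 => /eqP ->.
  by rewrite mul0r.
have Ap : (0 < A)%R by rewrite lt_neqAle eq_sym An0.
have : (0 <= \sum_i (A * b i - C * a i) ^+ 2)%R.
  by apply: sumr_ge0 => i _; exact: sqr_ge0.
have -> : (\sum_i (A * b i - C * a i) ^+ 2 = A * (A * B - C ^+ 2))%R.
  transitivity (\sum_i (A ^+ 2 * b i ^+ 2 - 2 * A * C * (a i * b i) +
      C ^+ 2 * a i ^+ 2))%R; first by apply: eq_bigr => i _; ring.
  rewrite big_split/= sumrB -!mulr_sumr -/A -/B -/C; ring.
by rewrite pmulr_rge0// subr_ge0.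
Qed.

Lemma norm2D (R : realType) (d : nat) (x y : 'rV[R]_d) :
  (norm2 (x + y) <= norm2 x + norm2 y)%R.
Proof.
rewrite /norm2; set A := (\sum_i x _ i ^+ 2)%R; set B := (\sum_i y _ i ^+ 2)%R.
have A0 : (0 <= A)%R by apply: sumr_ge0 => i _; exact: sqr_ge0.
have B0 : (0 <= B)%R by apply: sumr_ge0 => i _; exact: sqr_ge0.
rewrite -[leRHS]ger0_norm ?addr_ge0 ?sqrtr_ge0// -sqrtr_sqr ler_sqrt ?sqr_ge0//.
rewrite sqrrD !sqr_sqrtr//.
have -> : (\sum_i (x + y)%R ord0 i ^+ 2 =
    A + (\sum_i x ord0 i * y ord0 i) *+ 2 + B)%R.
  rewrite -sumrMnl -!big_split/=; apply: eq_bigr => i _.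
  by rewrite !mxE sqrrD.
rewrite lerD2r lerD2l lerMn2r/= -sqrtrM//.
rewrite (le_trans (ler_norm _))// -sqrtr_sqr ler_sqrt ?mulr_ge0//.
exact: sum_CauchySchwarz.
Qed.

Lemma norm2N (R : realType) (d : nat) (x : 'rV[R]_d) : norm2 (- x)%R = norm2 x.
Proof.
by rewrite /norm2; congr Num.sqrt; apply: eq_bigr => i _; rewrite mxE sqrrN.
Qed.

Lemma dist2_ge0 (R : realType) (d : nat) (x y : Rd R d) : (0 <= dist2 x y)%R.
Proof. exact: sqrtr_ge0. Qed.

Lemma dist2xx (R : realType) (d : nat) (x : Rd R d) : dist2 x x = 0%R.
Proof.
rewrite /dist2 /norm2 subrr big1 ?sqrtr0// => i _.
by rewrite mxE expr0n.
Qed.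

Lemma dist2_triangle (R : realType) (d : nat) (z x y : Rd R d) :
  (dist2 x y <= dist2 x z + dist2 y z)%R.
Proof.
rewrite /dist2 -(norm2N ((y : 'rV[R]_d) - (z : 'rV[R]_d))%R) opprB.
apply: le_trans (norm2D _ _); rewrite le_eqVlt; apply/orP; left; apply/eqP.
by congr norm2; rewrite addrA subrK.
Qed.

(** Splits the transport cost into a function of [x] plus the same function of [y], which is the
    form the coupling argument takes. *)
Lemma powR_dist2_le (R : realType) (d : nat) (p : R) (z x y : Rd R d) :
  (1 <= p -> dist2 x y `^ p <=
   2 `^ (p - 1) * (dist2 x z `^ p + dist2 y z `^ p))%R.
Proof.
move=> p1; apply: le_trans (powRD_le p1 (dist2_ge0 _ _) (dist2_ge0 _ _)).
by rewrite ge0_ler_powR ?nnegrE ?addr_ge0 ?dist2_ge0 ?dist2_triangle// (le_trans ler01).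
Qed.

Lemma measurable_coord (R : realType) (d : nat) (i : 'I_d) :
  measurable_fun [set: Rd R d] (fun x : Rd R d => (x : 'rV[R]_d) ord0 i).
Proof.
apply: (measurability _ (RGenOpens.measurableE R)).
move=> _ [_ [a [b ->] <-]]; rewrite setTI; apply: sub_sigma_algebra.
have /continuousP := @coord_continuous R 1 d ord0 i.
by apply; exact: interval_open.
Qed.

(** The domain carries the product sigma-algebra, so measurability is derived from the coordinates
    and the two projections rather than from joint continuity. *)
Lemma measurable_dist2 (R : realType) (d : nat) :
  measurable_fun [set: Rd R d * Rd R d]
    (fun z : Rd R d * Rd R d => dist2 z.1 z.2).
Proof.
apply: (measurableT_comp (@continuous_measurable_fun _ _ (@sqrt_continuous R))).
apply: measurable_sum => i; apply: measurable_funX.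
under eq_fun do rewrite mxE [X in (_ + X)%R]mxE.
by apply: measurable_funB;
  [exact: (measurableT_comp (measurable_coord i) measurable_fst)|
   exact: (measurableT_comp (measurable_coord i) measurable_snd)].
Qed.

(** * Moments of a density *)

Lemma ge0_integralD_EFin d (T : measurableType d) (R : realType)
    (mu : {measure set T -> \bar R}) (f g : T -> R) :
  measurable_fun setT f -> measurable_fun setT g ->
  (forall x, 0 <= f x)%R -> (forall x, 0 <= g x)%R ->
  \int[mu]_x (f x + g x)%:E = \int[mu]_x (f x)%:E + \int[mu]_x (g x)%:E.
Proof.
move=> mf mg f0 g0; under eq_integral do rewrite EFinD.
by rewrite ge0_integralD//; solve [
  by move=> x _; rewrite lee_fin | exact/measurable_EFinP].
Qed.

Lemma ge0_integralZl_EFin_fun d (T : measurableType d) (R : realType)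
    (mu : {measure set T -> \bar R}) (f : T -> R) (c : R) :
  measurable_fun setT f -> (forall x, 0 <= f x)%R -> (0 <= c)%R ->
  \int[mu]_x (c * f x)%:E = c%:E * \int[mu]_x (f x)%:E.
Proof.
move=> mf f0 c0; under eq_integral do rewrite EFinM.
by rewrite ge0_integralZl_EFin//;
  solve [by move=> x _; rewrite lee_fin | exact/measurable_EFinP].
Qed.

Lemma ge0_le_integral_EFin d (T : measurableType d) (R : realType)
    (mu : {measure set T -> \bar R}) (f g : T -> R) :
  measurable_fun setT f -> measurable_fun setT g ->
  (forall x, 0 <= f x)%R -> (forall x, f x <= g x)%R ->
  \int[mu]_x (f x)%:E <= \int[mu]_x (g x)%:E.
Proof.
move=> mf mg f0 fg; apply: ge0_le_integral => //;
  by [exact/measurable_EFinP | move=> x _; rewrite lee_fin].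
Qed.

Lemma probability_integral_cst d (T : measurableType d) (R : realType)
    (xi : probability T R) (c : R) : \int[xi]_x c%:E = c%:E.
Proof.
rewrite (integral_cst xi measurableT c%:E) [X in _ * X](probability_setT xi).
by rewrite mule1.
Qed.

(** From [(f - 1) ^ 2 + 2 f = f ^ 2 + 1]. With the cross term on the left all integrands are
    nonnegative, so an infinite second moment is covered as well. *)
Lemma integral_sqr_sub1 d (T : measurableType d) (R : realType)
    (xi : probability T R) (f : T -> R) :
  measurable_fun setT f -> (forall x, 0 <= f x)%R ->
  \int[xi]_x (f x)%:E = 1 ->
  \int[xi]_x ((f x - 1) ^+ 2)%:E = \int[xi]_x (f x ^+ 2)%:E - 1.
Proof.
move=> mf f0 f1.
have m1 : measurable_fun setT (fun x => (f x - 1) ^+ 2)%R.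
  by apply: measurable_funX; exact: measurable_funB.
have m2 : measurable_fun setT (fun x => (f x) ^+ 2)%R.
  exact: measurable_funX.
have m3 : measurable_fun setT (fun x => 2 * f x)%R by exact: measurable_funM.
have : \int[xi]_x ((f x - 1) ^+ 2 + 2 * f x)%:E = \int[xi]_x (f x ^+ 2 + 1)%:E.
  by apply: eq_integral => x _; congr EFin; ring.
rewrite ge0_integralD_EFin//; last 2 first.
- by move=> x; exact: sqr_ge0.
- by move=> x; rewrite mulr_ge0.
rewrite [RHS]ge0_integralD_EFin//; last by move=> x; exact: sqr_ge0.
rewrite ge0_integralZl_EFin_fun// f1 probability_integral_cst mule1.
set V := \int[xi]_x _; set S := \int[xi]_x _.
case: V => [v| |]; case: S => [s| |]//=; rewrite -!EFinD => -[]vs.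
by congr EFin; lra.
Qed.

(** Cauchy-Schwarz, as Hoelder with both exponents 2. The second factor is the square root of the
    chi-square divergence, rewritten by [integral_sqr_sub1]. *)
Lemma integral_mul_abs_sub1_le d (T : measurableType d) (R : realType)
    (xi : probability T R) (g f : T -> R) :
  measurable_fun setT g -> measurable_fun setT f ->
  (forall x, 0 <= g x)%R -> (forall x, 0 <= f x)%R ->
  \int[xi]_x (f x)%:E = 1 ->
  \int[xi]_x (g x * `|f x - 1|)%:E <=
  (\int[xi]_x (g x ^+ 2)%:E) `^ 2^-1 *
  (\int[xi]_x (f x ^+ 2)%:E - 1) `^ 2^-1.
Proof.
move=> mg mf g0 f0 f1.
have mf1 : measurable_fun setT (fun x => f x - 1)%R by exact: measurable_funB.
have := @hoelder _ _ _ xi g (fun x => f x - 1)%R 2 2 mg mf1 (ltr0Sn _ _) (ltr0Sn _ _).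
have -> : (2^-1 + 2^-1 = 1 :> R)%R by lra.
move=> /(_ erefl); rewrite Lnorm1 unlock.
rewrite -integral_sqr_sub1//.
under eq_integral do rewrite /= normrM (ger0_norm (g0 _)).
under [X in _ <= X `^ _ * _]eq_integral do rewrite /= powR_mulrn ?normr_ge0// real_normK ?num_real//.
under [X in _ <= _ * X `^ _]eq_integral do rewrite /= powR_mulrn ?normr_ge0// real_normK ?num_real//.
by [].
Qed.

(** [L] is the logarithm of a finite exponential moment, so [expR (h - L)] is a probability density:
    the exponential tilt of [xi] by [h]. *)
Lemma integral_expR_sub d (T : measurableType d) (R : realType)
    (xi : probability T R) (h : T -> R) (L : R) :
  measurable_fun setT h -> \int[xi]_x (expR (h x))%:E = (expR L)%:E ->
  \int[xi]_x (expR (h x - L))%:E = 1.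
Proof.
move=> mh hL; under eq_integral do rewrite expRB mulrC.
rewrite ge0_integralZl_EFin_fun// ?invr_ge0 ?expR_ge0//.
- by rewrite hL -EFinM mulVf// expR_eq0.
- exact: measurableT_comp.
Qed.

Lemma integral_expR_ge0 d (T : measurableType d) (R : realType)
    (xi : probability T R) (h : T -> R) (L : R) :
  measurable_fun setT h -> (forall x, 0 <= h x)%R ->
  \int[xi]_x (expR (h x))%:E = (expR L)%:E -> (0 <= L)%R.
Proof.
move=> mh h0 hL; rewrite -[(0 <= L)%R]ler_expR expR0 -lee_fin -hL.
rewrite -[leLHS](probability_integral_cst xi).
apply: ge0_le_integral_EFin => //; first exact: measurableT_comp.
by move=> x; rewrite -expR0 ler_expR.
Qed.

(** Jensen's inequality, obtained by integrating [1 + t <= exp t] at [t = h - L]. *)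
Lemma integral_le_expR d (T : measurableType d) (R : realType)
    (xi : probability T R) (h : T -> R) (L : R) :
  measurable_fun setT h -> (forall x, 0 <= h x)%R ->
  \int[xi]_x (expR (h x))%:E = (expR L)%:E -> \int[xi]_x (h x)%:E <= L%:E.
Proof.
move=> mh h0 hL; have L0 := integral_expR_ge0 mh h0 hL.
have mE : measurable_fun setT (fun x => expR (h x - L)).
  by apply: measurableT_comp => //; exact: measurable_funB.
have : \int[xi]_x (h x + 1)%:E <= \int[xi]_x (L + expR (h x - L))%:E.
  apply: ge0_le_integral_EFin.
  - exact: measurable_funD.
  - exact: measurable_funD.
  - by move=> x; rewrite addr_ge0.
  - by move=> x; have := @expR_ge1Dx R (h x - L); lra.
rewrite !ge0_integralD_EFin// ?integral_expR_sub ?probability_integral_cst//.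
by rewrite leeD2rE.
Qed.

(** Integrates [ler_sqr_expR]; the tilt has mass one, so [2 * L + 2] appears on both sides and
    cancels. *)
Lemma integral_sqr_le_expR d (T : measurableType d) (R : realType)
    (xi : probability T R) (h : T -> R) (L : R) :
  measurable_fun setT h -> (forall x, 0 <= h x)%R ->
  \int[xi]_x (expR (h x))%:E = (expR L)%:E ->
  \int[xi]_x (h x ^+ 2)%:E <= ((L + 3 / 2) ^+ 2)%:E.
Proof.
move=> mh h0 hL; have L0 := integral_expR_ge0 mh h0 hL.
have mE : measurable_fun setT (fun x => expR (h x - L)).
  by apply: measurableT_comp => //; exact: measurable_funB.
have mE2 : measurable_fun setT (fun x => (2 * L + 2) * expR (h x - L))%R.
  exact: measurable_funM.
have mh2 : measurable_fun setT (fun x => h x ^+ 2)%R by exact: measurable_funX.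
have c0 : (0 <= 2 * L + 2)%R by lra.
have e0 x : (0 <= (2 * L + 2) * expR (h x - L))%R by rewrite mulr_ge0// expR_ge0.
have : \int[xi]_x (h x ^+ 2 + (2 * L + 2))%:E <=
    \int[xi]_x ((L + 3 / 2) ^+ 2 + (2 * L + 2) * expR (h x - L))%:E.
  apply: ge0_le_integral_EFin.
  - exact: measurable_funD.
  - exact: measurable_funD.
  - by move=> x; rewrite addr_ge0 ?sqr_ge0.
  - by move=> x; have := ler_sqr_expR L0 (h0 x); lra.
rewrite !ge0_integralD_EFin//; try by move=> x; exact: sqr_ge0.
rewrite [X in _ <= _ + X]ge0_integralZl_EFin_fun//.
rewrite integral_expR_sub// !probability_integral_cst// mule1 leeD2rE//.
by move=> _; rewrite mulr_ge0.
Qed.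

(* Stands in for the Gibbs variational inequality, with the Renyi divergence
   [ln S] in place of the relative entropy. *)
Lemma integral_mul_density_le d (T : measurableType d) (R : realType)
    (xi : probability T R) (h f : T -> R) (L S : R) :
  measurable_fun setT h -> measurable_fun setT f ->
  (forall x, 0 <= h x)%R -> (forall x, 0 <= f x)%R ->
  \int[xi]_x (f x)%:E = 1 ->
  \int[xi]_x (expR (h x))%:E = (expR L)%:E ->
  \int[xi]_x (f x ^+ 2)%:E = S%:E -> (1 <= S)%R ->
  \int[xi]_x (h x * f x)%:E <= (ln S + L)%:E.
Proof.
move=> mh mf h0 f0 f1 hL fS S1; have L0 := integral_expR_ge0 mh h0 hL.
have S0 : (0 < S)%R by lra.
have lS0 : (0 <= ln S)%R by rewrite ln_ge0.
have mE : measurable_fun setT (fun x => expR (h x - L)).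
  by apply: measurableT_comp => //; exact: measurable_funB.
have mf2 : measurable_fun setT (fun x => S^-1 * f x ^+ 2)%R.
  by apply: measurable_funM => //; exact: measurable_funX.
have e0 x : (0 <= expR (h x - L))%R by exact: expR_ge0.
have f20 x : (0 <= S^-1 * f x ^+ 2)%R by rewrite mulr_ge0 ?sqr_ge0// invr_ge0 ltW.
have lf0 x : (0 <= (ln S + L) * f x)%R by rewrite mulr_ge0// addr_ge0.
have hf0 x : (0 <= h x * f x)%R by rewrite mulr_ge0.
have tf0 x : (0 <= 2 * f x)%R by rewrite mulr_ge0.
have mhf : measurable_fun setT (fun x => h x * f x)%R by exact: measurable_funM.
have mtf : measurable_fun setT (fun x => 2 * f x)%R by exact: measurable_funM.
have mlf : measurable_fun setT (fun x => (ln S + L) * f x)%R.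
  exact: measurable_funM.
have mfE : measurable_fun setT (fun x => S^-1 * f x ^+ 2 + expR (h x - L))%R.
  exact: measurable_funD.
have fE0 x : (0 <= S^-1 * f x ^+ 2 + expR (h x - L))%R by exact: addr_ge0.
(* [mulr_density_le] with [2 f] moved to the left, which keeps the integrands nonnegative. That term
   integrates to 2, and so does the inner sum on the right, each of its summands having integral
   1. *)
have : \int[xi]_x (h x * f x + 2 * f x)%:E <=
  \int[xi]_x ((ln S + L) * f x + (S^-1 * f x ^+ 2 + expR (h x - L)))%:E.
  apply: ge0_le_integral_EFin.
  - exact: measurable_funD.
  - exact: measurable_funD.
  - by move=> x; rewrite addr_ge0.
  - move=> x; have := mulr_density_le L (h x) S0 (f0 x).
    by rewrite (mulrC S^-1%R); lra.
rewrite !ge0_integralD_EFin// !ge0_integralZl_EFin_fun//.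
- rewrite integral_expR_sub// f1 fS !mule1 -EFinM mulVf ?gt_eqF//.
  have -> : (1%:E + 1 = 2%:E :> \bar R) by rewrite -EFinD.
  by rewrite leeD2rE.
- exact: measurable_funX.
- by move=> x; exact: sqr_ge0.
- by rewrite invr_ge0 ltW.
- exact: addr_ge0.
Qed.

Lemma integral_expR_mul_abs_sub1_le d (T : measurableType d) (R : realType)
    (xi : probability T R) (h f : T -> R) (L K : R) :
  measurable_fun setT h -> measurable_fun setT f ->
  (forall x, 0 <= h x)%R -> (forall x, 0 <= f x)%R ->
  \int[xi]_x (f x)%:E = 1 ->
  \int[xi]_x (expR (h x))%:E = (expR L)%:E ->
  1 <= \int[xi]_x (f x ^+ 2)%:E -> \int[xi]_x (f x ^+ 2)%:E <= (expR K)%:E ->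
  \int[xi]_x (h x * `|f x - 1|)%:E <=
  ((3 / 2 + L) * (Num.sqrt (2 * K) + 2 * K))%:E.
Proof.
move=> mh mf h0 f0 f1 hL S1 SK; have L0 := integral_expR_ge0 mh h0 hL.
have : \int[xi]_x (f x ^+ 2)%:E \is a fin_num.
  rewrite ge0_fin_numE ?(le_lt_trans SK) ?ltry//.
  exact: le_trans S1.
move=> /fineK; move: (fine _) => S /esym fS.
rewrite fS !lee_fin in S1 SK.
have K0 : (0 <= K)%R by rewrite -ler_expR expR0 (le_trans S1).
have lSK : (ln S <= K)%R.
  by rewrite -[leRHS]expRK ler_ln ?posrE ?expR_gt0//; lra.
have sq0 : (0 <= Num.sqrt (2 * K))%R := sqrtr_ge0 _.
(* Small [K]: Cauchy-Schwarz, as [sqrt (exp K - 1) <= sqrt (2 * K)].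
   Large [K]: bound [`|f - 1|] by [f + 1]. *)
have [K12|K12] := leP K (1 / 2)%R.
- apply: (le_trans (integral_mul_abs_sub1_le mh mf h0 f0 f1)).
  rewrite fS -EFinD.
  have eS : ((S - 1) `^ 2^-1 <= Num.sqrt (2 * K))%R.
    rewrite powR12_sqrt ?ler_wsqrtr//; last lra.
    by have := expR_sub1_le2 K0 K12; lra.
  have eh : (\int[xi]_x (h x ^+ 2)%:E) `^ 2^-1 <= (3 / 2 + L)%:E.
    have -> : (3 / 2 + L)%:E = (((L + 3 / 2) ^+ 2)%:E : \bar R) `^ 2^-1.
      rewrite poweR_EFin powR12_sqrt ?sqr_ge0// sqrtr_sqr ger0_norm ?(addrC L)//.
      lra.
    apply: gt0_ler_poweR => //; last exact: integral_sqr_le_expR.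
      rewrite in_itv/= leey andbT; apply: integral_ge0 => x _.
      by rewrite lee_fin sqr_ge0.
    by rewrite in_itv/= leey andbT lee_fin sqr_ge0.
  apply: (@le_trans _ _ ((3 / 2 + L)%:E * (Num.sqrt (2 * K))%:E)).
    by apply: lee_pmul => //; [exact: poweR_ge0|exact: poweR_ge0].
  by rewrite -EFinM lee_fin ler_wpM2l//; lra.
- have K1 : (1 <= Num.sqrt (2 * K))%R.
    by rewrite -[leLHS]sqrtr1 ler_wsqrtr//; lra.
  apply: (@le_trans _ _ (\int[xi]_x (h x * f x + h x)%:E)).
    apply: ge0_le_integral_EFin.
    + apply: measurable_funM => //; apply: measurableT_comp => //.
      exact: measurable_funB.
    + by apply: measurable_funD => //; exact: measurable_funM.
    + by move=> x; rewrite mulr_ge0.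
    + move=> x; rewrite -[X in (_ <= _ + X)%R]mulr1 -mulrDr ler_wpM2l//.
      by rewrite ler_norml; have := f0 x; lra.
  rewrite ge0_integralD_EFin//; last 2 first.
    exact: measurable_funM.
    by move=> x; rewrite mulr_ge0.
  apply: (@le_trans _ _ ((ln S + L)%:E + L%:E)).
    apply: leeD; first exact: integral_mul_density_le.
    exact: integral_le_expR.
  (* Both [Num.sqrt (2 * K)] and [2 * K] are at least 1, so [L] gets a factor of at least 2, while
     [3 / 2 * (2 * K)] already exceeds [K >= ln S]. *)
  by rewrite -EFinD lee_fin; nra.
Qed.

(** A vanishing moment of order [r] forces [g = 0] almost everywhere, which then annihilates any
    other positive power of [g] against any weight. *)
Lemma ae_integral_powR0 d (T : measurableType d) (R : realType)
    (xi : probability T R) (g u : T -> R) (r s : R) :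
  measurable_fun setT g -> measurable_fun setT u ->
  (forall x, 0 <= g x)%R -> (forall x, 0 <= u x)%R -> (0 < r)%R -> (0 < s)%R ->
  \int[xi]_x (g x `^ r)%:E = 0 -> \int[xi]_x (g x `^ s * u x)%:E = 0.
Proof.
move=> mg mu g0 u0 r0 s0 gr.
have mp t : measurable_fun setT (fun x => g x `^ t)%R.
  exact: (measurableT_comp (measurable_powR t) mg).
rewrite -(integral0 xi setT); apply: ae_eq_integral => //.
  by apply/measurable_EFinP; exact: measurable_funM.
have : ae_eq xi setT (fun x => (g x `^ r)%:E) (cst 0).
  apply/ae_eq_integral_abs => //; first exact/measurable_EFinP.
  rewrite -[RHS]gr; apply: eq_integral => x _.
  by rewrite gee0_abs// lee_fin powR_ge0.
apply: filterS => x /(_ I) [/eqP]; rewrite powR_eq0 => /andP[/eqP -> _] _.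
by rewrite powR0 ?mul0r// gt_eqF.
Qed.

(** * The coupling *)

(** The proofs [mm] and [m0] are arguments so that the measure structure attached below can be
    inferred from the term itself. *)
Definition density_measure d (T : measurableType d) (R : realType)
    (mu : {measure set T -> \bar R}) (m : T -> R)
    (mm : measurable_fun setT m) (m0 : forall x, (0 <= m x)%R)
    (A : set T) : \bar R := \int[mu]_(x in A) (m x)%:E.

Lemma density_measure0 d (T : measurableType d) (R : realType)
    (mu : {measure set T -> \bar R}) (m : T -> R)
    (mm : measurable_fun setT m) (m0 : forall x, (0 <= m x)%R) :
  density_measure mu mm m0 set0 = 0.
Proof. exact: integral_set0. Qed.

Lemma density_measure_ge0 d (T : measurableType d) (R : realType)
    (mu : {measure set T -> \bar R}) (m : T -> R)
    (mm : measurable_fun setT m) (m0 : forall x, (0 <= m x)%R) A :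
  0 <= density_measure mu mm m0 A.
Proof. by apply: integral_ge0 => x _; rewrite lee_fin. Qed.

Lemma density_measure_sigma_additive d (T : measurableType d) (R : realType)
    (mu : {measure set T -> \bar R}) (m : T -> R)
    (mm : measurable_fun setT m) (m0 : forall x, (0 <= m x)%R) :
  semi_sigma_additive (density_measure mu mm m0).
Proof.
apply: semi_sigma_additive_nng_induced; first exact/measurable_EFinP.
by move=> x; rewrite lee_fin.
Qed.

HB.instance Definition _ d (T : measurableType d) (R : realType)
    (mu : {measure set T -> \bar R}) (m : T -> R)
    (mm : measurable_fun setT m) (m0 : forall x, (0 <= m x)%R) :=
  isMeasure.Build _ _ _ (density_measure mu mm m0) (@density_measure0 _ _ _ mu m mm m0)
    (@density_measure_ge0 _ _ _ mu m mm m0)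
    (@density_measure_sigma_additive _ _ _ mu m mm m0).

(** Finite mass makes this a finite measure dominated by [mu]. Its Radon-Nikodym derivative equals
    [m] almost everywhere, both having the same integral over every measurable set, so the change of
    variables formula applies. *)
Lemma integral_density_measure d (T : measurableType d) (R : realType)
    (mu : {sigma_finite_measure set T -> \bar R}) (m : T -> R)
    (mm : measurable_fun setT m) (m0 : forall x, (0 <= m x)%R) (F : T -> R) :
  \int[mu]_x (m x)%:E < +oo -> measurable_fun setT F ->
  (forall x, 0 <= F x)%R ->
  \int[density_measure mu mm m0]_x (F x)%:E = \int[mu]_x (m x * F x)%:E.
Proof.
move=> moo mF F0.
have nu_fin : fin_num_fun (density_measure mu mm m0).
  move=> A mA; rewrite ge0_fin_numE; last exact: density_measure_ge0.
  apply: le_lt_trans moo; apply: ge0_subset_integral => //.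
    exact/measurable_EFinP.
  by move=> x _; rewrite lee_fin.
pose nu : {finite_measure set T -> \bar R} := HB.pack (density_measure mu mm m0)
  (Measure_isFinite.Build _ _ _ (density_measure mu mm m0) nu_fin).
have numu : nu `<< mu.
  apply/null_content_dominatesP => A mA A0; rewrite /= /density_measure.
  rewrite (ae_eq_integral (cst 0))//; first exact: integral0.
    by apply/measurable_EFinP; exact: measurable_funTS.
  exact: ae_eq0.
rewrite -[LHS]/(\int[nu]_x (F x)%:E).
rewrite -(Radon_Nikodym_SigmaFinite.change_of_variables numu)//; last first.
  exact/measurable_EFinP.
have iRN := Radon_Nikodym_SigmaFinite.f_integrable numu.
have mRN := measurable_int _ iRN.
have mF' : measurable_fun setT (fun x => (F x)%:E) by exact/measurable_EFinP.
apply: ae_eq_integral => //.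
- exact: emeasurable_funM.
- by apply/measurable_EFinP; exact: measurable_funM.
have : ae_eq mu setT (Radon_Nikodym_SigmaFinite.f nu mu) (fun x => (m x)%:E).
  apply: integral_ae_eq => //; first exact/measurable_EFinP.
  by move=> E _ mE; rewrite -Radon_Nikodym_SigmaFinite.f_integral.
by apply: filterS => x /(_ I) /= -> _; rewrite mulrC EFinM.
Qed.

Definition image_measure d1 d2 (T1 : measurableType d1) (T2 : measurableType d2)
    (R : realType) (mu : {measure set T1 -> \bar R}) (phi : T1 -> T2)
    (mphi : measurable_fun setT phi) : {measure set T2 -> \bar R}.
Proof. by unshelve refine (pushforward mu phi : {measure set _ -> \bar R}). Defined.

Lemma measurable_diag d (T : measurableType d) :
  measurable_fun [set: T] (fun x : T => (x, x)).
Proof. exact: measurable_fun_pair. Qed.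

(** Serves the mass left in place: the measure with density [m] is carried to the diagonal. *)
Lemma integral_image_density d (T : measurableType d) (R : realType)
    (xi : probability T R) (m : T -> R)
    (mm : measurable_fun setT m) (m0 : forall x, (0 <= m x)%R) (F : T * T -> R) :
  \int[xi]_x (m x)%:E < +oo -> measurable_fun setT F ->
  (forall z, 0 <= F z)%R ->
  \int[image_measure (density_measure xi mm m0) (@measurable_diag d T)]_z (F z)%:E =
  \int[xi]_x (m x * F (x, x))%:E.
Proof.
move=> moo mF F0.
have mF' : measurable_fun setT (EFin \o F) by exact/measurable_EFinP.
rewrite (ge0_integral_pushforward (@measurable_diag d T))//=; last first.
  by move=> z _; rewrite lee_fin.
rewrite preimage_setT integral_density_measure//.
exact: measurableT_comp mF (@measurable_diag d T).
Qed.

Lemma integral_prod_mul d (T : measurableType d) (R : realType)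
    (xi : probability T R) (phi psi : T -> R) :
  measurable_fun setT phi -> measurable_fun setT psi ->
  (forall x, 0 <= phi x)%R -> (forall x, 0 <= psi x)%R ->
  \int[xi \x xi]_z (phi z.1 * psi z.2)%:E =
  \int[xi]_x (phi x)%:E * \int[xi]_x (psi x)%:E.
Proof.
move=> mphi mpsi phi0 psi0.
rewrite fubini_tonelli1//=; last 2 first.
- apply/measurable_EFinP; apply: measurable_funM.
    exact: measurableT_comp mphi measurable_fst.
  exact: measurableT_comp mpsi measurable_snd.
- by move=> z; rewrite lee_fin mulr_ge0.
rewrite -ge0_integralZr//.
- by apply: eq_integral => x _; rewrite /fubini_F/= ge0_integralZl_EFin_fun.
- exact/measurable_EFinP.
- by move=> x _; rewrite lee_fin.
- by apply: integral_ge0 => x _; rewrite lee_fin.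
Qed.

(** Normalising a product by [a] cancels the mass of the other factor. If [a = 0], then [u] vanishes
    almost everywhere and both sides are zero. *)
Lemma integral_mul_total_mass d (T : measurableType d) (R : realType)
    (xi : probability T R) (u phi : T -> R) (a : R) :
  measurable_fun setT u -> measurable_fun setT phi ->
  (forall x, 0 <= u x)%R -> (forall x, 0 <= phi x)%R ->
  \int[xi]_x (u x)%:E = a%:E ->
  a^-1%:E * (\int[xi]_x (u x * phi x)%:E * a%:E) = \int[xi]_x (u x * phi x)%:E.
Proof.
move=> mu mphi u0 phi0 ua.
have [a0|a0] := eqVneq a 0%R.
  rewrite a0 !mule0.
  rewrite -[LHS](@ae_integral_powR0 _ _ _ xi u phi 1 1)//.
    by apply: eq_integral => x _; rewrite powRr1.
  by under eq_integral do rewrite powRr1//; rewrite ua a0.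
by rewrite muleCA -EFinM mulVf// mule1.
Qed.

(** The common mass [m = min f 1] stays on the diagonal; the deficit [u] and the excess [v] of [f]
    relative to 1 have equal mass [a] and are coupled by the density [u x * v y / a]. The diagonal
    is free of cost, and off it the bound [g x + g y] only involves the marginals, giving the
    integral of [g * (u + v)]. *)
Lemma exists_maximal_coupling d (T : measurableType d) (R : realType)
    (xi : probability T R) (f : T -> R) :
  measurable_fun setT f -> (forall x, 0 <= f x)%R ->
  \int[xi]_x (f x)%:E = 1 ->
  exists gamma : probability (T * T)%type R,
    (forall A, measurable A -> gamma (A `*` setT) = xi A /\
       gamma (setT `*` A) = \int[xi]_(x in A) (f x)%:E) /\
    forall (c : T * T -> R) (g : T -> R),
      measurable_fun setT c -> measurable_fun setT g ->
      (forall z, 0 <= c z)%R -> (forall x, 0 <= g x)%R ->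
      (forall x, c (x, x) = 0)%R ->
      (forall x y, c (x, y) <= g x + g y)%R ->
      \int[gamma]_z (c z)%:E <= \int[xi]_x (g x * `|f x - 1|)%:E.
Proof.
move=> mf f0 f1.
pose m x := Num.min (f x) 1%R.
pose u x := Num.max (1 - f x)%R 0%R.
pose v x := Num.max (f x - 1)%R 0%R.
have mm : measurable_fun setT m by exact: measurable_minr.
have mu : measurable_fun setT u.
  by apply: measurable_maxr => //; exact: measurable_funB.
have mv : measurable_fun setT v.
  by apply: measurable_maxr => //; exact: measurable_funB.
have m0 x : (0 <= m x)%R by rewrite /m le_min f0 ler01.
have u0 x : (0 <= u x)%R by rewrite /u le_max lexx orbT.
have v0 x : (0 <= v x)%R by rewrite /v le_max lexx orbT.
have mDu x : (m x + u x = 1)%R by rewrite /m /u minEle maxEle; case: leP => ?; case: leP => ?; lra.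
have mDv x : (m x + v x = f x)%R by rewrite /m /v minEle maxEle; case: leP => ?; case: leP => ?; lra.
have uDv x : (u x + v x = `|f x - 1|)%R.
  by rewrite /u /v !maxEle; case: (ger0P (f x - 1)%R) => ?; case: leP => ?; case: leP => ?; lra.
have im1 : \int[xi]_x (m x)%:E + \int[xi]_x (u x)%:E = 1.
  rewrite -ge0_integralD_EFin//; under eq_integral do rewrite mDu.
  exact: probability_integral_cst.
have im2 : \int[xi]_x (m x)%:E + \int[xi]_x (v x)%:E = 1.
  by rewrite -ge0_integralD_EFin//; under eq_integral do rewrite mDv.
(* Both [u] and [v] complete [m] to total mass one; the mass of [m] is at most 1, so it may be
   subtracted. *)
have [b [a [ib iu iv]]] : exists b a, [/\ \int[xi]_x (m x)%:E = b%:E,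
    \int[xi]_x (u x)%:E = a%:E & \int[xi]_x (v x)%:E = a%:E].
  have mfin : \int[xi]_x (m x)%:E \is a fin_num.
    rewrite ge0_fin_numE; last first.
      by apply: integral_ge0 => x _; rewrite lee_fin.
    apply: (@le_lt_trans _ _ 1); last exact: ltry.
    rewrite -(probability_integral_cst xi); apply: ge0_le_integral_EFin => //.
    by move=> x; rewrite /m ge_min lexx orbT.
  exists (fine (\int[xi]_x (m x)%:E)), (1 - fine (\int[xi]_x (m x)%:E))%R.
  split; rewrite ?EFinB fineK//.
    by rewrite -[in RHS]im1 addeAC subee// add0e.
  by rewrite -[in RHS]im2 addeAC subee// add0e.
have a0 : (0 <= a)%R.
  by rewrite -lee_fin -iu; apply: integral_ge0 => x _; rewrite lee_fin.
(* If [a = 0], the inverse is 0 by convention, so [w] is zero and all the mass sits on the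
   diagonal. *)
pose w (z : T * T) := (a^-1 * (u z.1 * v z.2))%R.
have muv : measurable_fun setT (fun z : T * T => u z.1 * v z.2)%R.
  apply: measurable_funM; first exact: measurableT_comp mu measurable_fst.
  exact: measurableT_comp mv measurable_snd.
have mw : measurable_fun setT w by exact: measurable_funM.
have w0 z : (0 <= w z)%R by rewrite /w !mulr_ge0// invr_ge0.
have iw (phi psi : T -> R) : measurable_fun setT phi -> measurable_fun setT psi ->
    (forall x, 0 <= phi x)%R -> (forall x, 0 <= psi x)%R ->
    \int[xi \x xi]_z (w z * (phi z.1 * psi z.2))%:E =
    a^-1%:E * (\int[xi]_x (u x * phi x)%:E * \int[xi]_x (v x * psi x)%:E).
  move=> mphi mpsi phi0 psi0.
  have muphi : measurable_fun setT (fun x => u x * phi x)%R.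
    exact: measurable_funM.
  have mvpsi : measurable_fun setT (fun x => v x * psi x)%R.
    exact: measurable_funM.
  have uphi0 x : (0 <= u x * phi x)%R by rewrite mulr_ge0.
  have vpsi0 x : (0 <= v x * psi x)%R by rewrite mulr_ge0.
  rewrite -integral_prod_mul// -ge0_integralZl_EFin_fun//.
  - by apply: eq_integral => z _; rewrite /w; congr EFin; ring.
  - apply: measurable_funM; first exact: measurableT_comp muphi measurable_fst.
    exact: measurableT_comp mvpsi measurable_snd.
  - by move=> z; rewrite mulr_ge0.
  - by rewrite invr_ge0.
have iwl (phi : T -> R) : measurable_fun setT phi -> (forall x, 0 <= phi x)%R ->
    \int[xi \x xi]_z (w z * phi z.1)%:E = \int[xi]_x (u x * phi x)%:E.
  move=> mphi phi0; have := iw phi (cst 1%R) mphi (measurable_cst _) phi0 _.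
  under eq_integral do rewrite mulr1.
  move=> ->//; under [X in _ * (_ * X)]eq_integral do rewrite mulr1.
  by rewrite iv integral_mul_total_mass.
have iwr (psi : T -> R) : measurable_fun setT psi -> (forall x, 0 <= psi x)%R ->
    \int[xi \x xi]_z (w z * psi z.2)%:E = \int[xi]_x (v x * psi x)%:E.
  move=> mpsi psi0; have := iw (cst 1%R) psi (measurable_cst _) mpsi _ psi0.
  under eq_integral do rewrite mul1r.
  move=> ->//; under [X in _ * (X * _)]eq_integral do rewrite mulr1.
  by rewrite iu [X in _ * X]muleC integral_mul_total_mass.
have woo : \int[xi \x xi]_z (w z)%:E < +oo.
  have := iwl (cst 1%R) (measurable_cst _) (fun=> ler01).
  under eq_integral do rewrite mulr1.
  by move=> ->; under eq_integral do rewrite mulr1; rewrite iu ltry.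
have moo : \int[xi]_x (m x)%:E < +oo by rewrite ib ltry.
pose xi2 : probability (T * T)%type R := (xi \x xi)%E.
pose nu : {measure set (T * T) -> \bar R} := measure_add
  (image_measure (density_measure xi mm m0) (@measurable_diag d T))
  (density_measure xi2 mw w0).
have inu (F : T * T -> R) : measurable_fun setT F -> (forall z, 0 <= F z)%R ->
    \int[nu]_z (F z)%:E =
    \int[xi]_x (m x * F (x, x))%:E + \int[xi \x xi]_z (w z * F z)%:E.
  move=> mF F0; rewrite ge0_integral_measure_add//; last 2 first.
  - by move=> z _; rewrite lee_fin.
  - exact/measurable_EFinP.
  congr (_ + _); first exact: integral_image_density.
  exact: (@integral_density_measure _ _ _ xi2 w mw w0 F woo mF F0).
(* The marginals come from [inu] at indicators of rectangles: [m + u = 1] for the first, [m + v = f]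
   for the second. *)
have nu_l A : measurable A -> nu (A `*` setT) = xi A.
  move=> mA; have mA1 : measurable_fun setT (\1_A : T -> R).
    exact: measurable_indic.
  transitivity (\int[nu]_z (\1_(A `*` setT) z)%:E).
    by rewrite integral_indic ?setIT//; exact: measurableX.
  have E z : (\1_(A `*` setT) z : R) = (\1_A z.1 : R).
    by rewrite !indicE in_setX in_setT andbT.
  under eq_integral do rewrite E.
  rewrite (inu (fun z => \1_A z.1)) ?iwl//; last first.
    exact: measurableT_comp mA1 measurable_fst.
  rewrite -ge0_integralD_EFin//; try exact: measurable_funM.
  - under eq_integral do rewrite -mulrDl mDu mul1r.
    by rewrite integral_indic// setIT.
  - by move=> x; rewrite mulr_ge0.
  - by move=> x; rewrite mulr_ge0.
have nu_r A : measurable A -> nu (setT `*` A) = \int[xi]_(x in A) (f x)%:E.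
  move=> mA; have mA1 : measurable_fun setT (\1_A : T -> R).
    exact: measurable_indic.
  transitivity (\int[nu]_z (\1_(setT `*` A) z)%:E).
    by rewrite integral_indic ?setIT//; exact: measurableX.
  have E z : (\1_(setT `*` A) z : R) = (\1_A z.2 : R).
    by rewrite !indicE in_setX in_setT.
  under eq_integral do rewrite E.
  rewrite (inu (fun z => \1_A z.2)) ?iwr//; last first.
    exact: measurableT_comp mA1 measurable_snd.
  rewrite -ge0_integralD_EFin//; try exact: measurable_funM.
  - under eq_integral do rewrite -mulrDl mDv.
    rewrite [RHS]integral_mkcond; apply: eq_integral => x _.
    by rewrite patchE indicE; case: ifPn => _; rewrite ?mulr1 ?mulr0.
  - by move=> x; rewrite mulr_ge0.
  - by move=> x; rewrite mulr_ge0.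
have nuT : nu setT = 1 by rewrite -setXTT nu_l// probability_setT.
pose gamma : probability (T * T)%type R :=
  HB.pack (Measure.sort nu) (Measure_isProbability.Build _ _ _ (Measure.sort nu) nuT).
exists gamma; split; first by move=> A mA; split; [exact: nu_l|exact: nu_r].
move=> c g mc mg c0 g0 cxx cle; rewrite -[leLHS]/(\int[nu]_z (c z)%:E) inu//.
under [X in X + _]eq_integral do rewrite cxx mulr0.
rewrite integral0 add0e.
have mg1 : measurable_fun setT (fun z : T * T => w z * g z.1)%R.
  by apply: measurable_funM => //; exact: measurableT_comp mg measurable_fst.
have mg2 : measurable_fun setT (fun z : T * T => w z * g z.2)%R.
  by apply: measurable_funM => //; exact: measurableT_comp mg measurable_snd.
apply: (@le_trans _ _ (\int[xi \x xi]_z (w z * g z.1 + w z * g z.2)%:E)).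
  apply: ge0_le_integral_EFin.
  - exact: measurable_funM.
  - exact: measurable_funD.
  - by move=> z; rewrite mulr_ge0.
  - by case=> x y; rewrite -mulrDr ler_wpM2l.
rewrite ge0_integralD_EFin//; last 2 first.
- by move=> z; rewrite mulr_ge0.
- by move=> z; rewrite mulr_ge0.
rewrite iwl// iwr// -ge0_integralD_EFin//; try exact: measurable_funM.
- rewrite le_eqVlt; apply/orP; left; apply/eqP; apply: eq_integral => x _.
  by rewrite -mulrDl uDv mulrC.
- by move=> x; rewrite mulr_ge0.
- by move=> x; rewrite mulr_ge0.
Qed.

(** * Divergence and evidence lower bound *)

(** Supplies a version of the derivative that is real and nonnegative at every point, not just
    almost everywhere. *)
Lemma exists_density d (T : measurableType d) (R : realType)
    (nu : {finite_measure set T -> \bar R}) (xi : probability T R) :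
  nu `<< xi ->
  exists f : T -> R, [/\ measurable_fun setT f, (forall x, 0 <= f x)%R,
    (forall A, measurable A -> nu A = \int[xi]_(x in A) (f x)%:E) &
    ae_eq xi setT (Radon_Nikodym (charge_of_finite_measure nu) xi)
      (EFin \o f)].
Proof.
move=> nuxi; pose F := Radon_Nikodym_SigmaFinite.f nu xi.
have FE x : (fine (F x))%:E = F x.
  by rewrite fineK//; exact: Radon_Nikodym_SigmaFinite.f_fin_num.
exists (fine \o F); split.
- apply/measurable_EFinP; have -> : EFin \o (fine \o F) = F.
    by apply/funext => x; rewrite /= FE.
  exact: measurable_int (Radon_Nikodym_SigmaFinite.f_integrable nuxi).
- by move=> x; rewrite fine_ge0// Radon_Nikodym_SigmaFinite.f_ge0.
- move=> A mA; rewrite (Radon_Nikodym_SigmaFinite.f_integral nuxi mA).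
  by apply: eq_integral => x _; rewrite /= FE.
- have -> : EFin \o (fine \o F) = F by apply/funext => x; rewrite /= FE.
  exact/ae_eq_sym/(ae_eq_Radon_Nikodym_SigmaFinite nuxi).
Qed.

(** At order 2 the prefactor is 1, and integrating [f] against [pi] is integrating [f ^ 2] against
    [xi]. Domination turns the equality of densities [xi]-almost everywhere into one [pi]-almost
    everywhere. *)
Lemma renyi2E (R : realType) (d : nat) (pi xi : probability (Rd R d) R)
    (f : Rd R d -> R) : pi `<< xi ->
  measurable_fun setT f -> (forall x, 0 <= f x)%R ->
  (forall A, measurable A -> pi A = \int[xi]_(x in A) (f x)%:E) ->
  ae_eq xi setT (density pi xi) (EFin \o f) ->
  renyi 2 pi xi = lne (\int[xi]_x (f x ^+ 2)%:E).
Proof.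
move=> pixi mf f0 pif fE; rewrite /renyi.
have -> : (2 - 1 = 1 :> R)%R by lra.
rewrite invr1 mul1e; congr lne.
have md : measurable_fun setT (density pi xi).
  exact: measurable_int
    (@Radon_Nikodym_integrable _ _ _ (charge_of_finite_measure pi) xi pixi).
transitivity (\int[pi]_x (f x)%:E).
  apply: ae_eq_integral => //.
  - exact: (measurableT_comp (measurable_poweR 1) md).
  - exact/measurable_EFinP.
  have := null_dominates_ae_eq measurableT pixi fE.
  by apply: filterS => x /(_ I) -> _; rewrite /= powRr1.
rewrite (@eq_measure_integral _ _ _ _ (density_measure xi mf f0)); last first.
  by move=> A mA _; exact: pif.
rewrite integral_density_measure//.
by rewrite -pif// probability_setT ltry.
Qed.

Lemma measurable_lne_EFin d (T : measurableType d) (R : realType) (g : T -> R) :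
  measurable_fun setT g -> measurable_fun setT (fun x => lne (g x)%:E).
Proof.
move=> mg; apply: measurable_fun_ifT => //; first exact: measurable_fun_ler.
by apply/measurable_EFinP; exact: (measurableT_comp (@measurable_ln R) mg).
Qed.

(** With [m] the total mass and [q] the density, the tangent of the logarithm at [m] gives
    [ln q <= ln m - 1 + q / m], and the right-hand side integrates to [ln m]. *)
Lemma ELBO_le (R : realType) (d : nat)
    (pistar : {finite_measure set (Rd R d) -> \bar R})
    (eta : probability (Rd R d) R) :
  0 < pistar setT -> pistar `<< eta -> ELBO pistar eta <= lne (pistar setT).
Proof.
move=> M0 pieta.
have [q [mq q0 piq qE]] := exists_density pieta.
have [m m0 Mm] : exists2 m : R, (0 < m)%R & pistar setT = m%:E.
  exists (fine (pistar setT)); last by rewrite fineK// fin_num_measure.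
  by rewrite fine_gt0// M0/= ltey_eq fin_num_measure.
rewrite Mm lne_EFin//.
have iq : \int[eta]_x (q x)%:E = m%:E by rewrite -piq.
have mlq : measurable_fun setT (fun x => lne (q x)%:E).
  exact: measurable_lne_EFin.
have mr : measurable_fun setT (fun x => (ln m - 1 + m^-1 * q x)%:E).
  by apply/measurable_EFinP; apply: measurable_funD => //; exact: measurable_funM.
have -> : ELBO pistar eta = \int[eta]_x lne (q x)%:E.
  apply: ae_eq_integral => //.
  - have dfin x := @Radon_Nikodym_fin_num _ _ _ (charge_of_finite_measure pistar)
      eta x pieta.
    have mfd : measurable_fun setT (fine \o density pistar eta).
      apply: measurableT_comp => //; exact: measurable_int
        (@Radon_Nikodym_integrable _ _ _ (charge_of_finite_measure pistar) eta pieta).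
    have := measurable_lne_EFin mfd; congr (measurable_fun setT _).
    by apply/funext => x; congr lne; exact: fineK (dfin x).
  - by move: qE; apply: filterS => x /(_ I) qx _; rewrite -[density _ _ x]/(Radon_Nikodym (charge_of_finite_measure pistar) eta x) qx.
have iqq : eta.-integrable setT (EFin \o q).
  apply/integrableP; split; first exact/measurable_EFinP.
  under eq_integral do rewrite gee0_abs ?lee_fin//.
  by rewrite iq ltry.
have <- : \int[eta]_x (ln m - 1 + m^-1 * q x)%:E = (ln m)%:E.
  under eq_integral do rewrite EFinD EFinM.
  rewrite integralD//=; last 2 first.
  - exact: finite_measure_integrable_cst.
  - exact: integrableZl.
  rewrite integralZl// iq probability_integral_cst -EFinM mulVf ?gt_eqF//.
  by rewrite -EFinD subrK.
have le_lq x : lne (q x)%:E <= (ln m - 1 + m^-1 * q x)%:E.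
  have := q0 x; rewrite le_eqVlt => /predU1P[<-|qx0].
    by rewrite le0_lneNy// leNye.
  rewrite lne_EFin// lee_fin.
  have : (ln (m^-1 * q x) <= m^-1 * q x - 1)%R.
    have := @le_ln1Dx R (m^-1 * q x - 1)%R.
    rewrite addrCA subrr addr0; apply.
    by rewrite ltrBrDl subrr mulr_gt0// invr_gt0.
  by rewrite lnM ?posrE ?invr_gt0// lnV ?posrE//; lra.
(* The logarithm of [q] may fail to be integrable, so positive and negative parts are compared
   separately. *)
rewrite integralE [leRHS]integralE leeB//.
- apply: ge0_le_integral => //.
  + exact: measurable_funepos.
  + exact: measurable_funepos.
  + by move=> x _; apply: (@funepos_le _ _ setT); rewrite ?inE// => ? _; exact: le_lq.
- apply: ge0_le_integral => //.
  + exact: measurable_funeneg.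
  + exact: measurable_funeneg.
  + by move=> x _; apply: (@funeneg_le _ _ setT); rewrite ?inE// => ? _; exact: le_lq.
Qed.

(** At order 2 the right-hand side is [t + 2 (m - E)]. It is infinite when [t = +oo] or [E = -oo],
    and [E = +oo] is excluded by [E <= m]. *)
Lemma lne_le_bound (R : realType) (t E : \bar R) (m : R) :
  0 <= t -> E <= m%:E ->
  t <= (2 / (2 - 1))%:E * ((1 - 2^-1)%:E * t + m%:E - E).
Proof.
have -> : (2 / (2 - 1) = 2 :> R)%R by field.
have -> : (1 - 2^-1 = 2^-1 :> R)%R by lra.
case: t => [t| |] // t0; case: E => [e| |]// eM.
- have -> : 2%:E * ((2^-1)%:E * t%:E + m%:E - e%:E) =
      (2 * (2^-1 * t + m - e))%:E by [].
  by move: eM; rewrite !lee_fin; lra.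
- by rewrite -EFinM -EFinD addey// gt0_muley ?lte_fin// leey.
- have -> : (2^-1)%:E * +oo = +oo :> \bar R.
    by rewrite gt0_muley// lte_fin invr_gt0.
  by rewrite /= gt0_muley ?lte_fin.
- have -> : (2^-1)%:E * +oo = +oo :> \bar R.
    by rewrite gt0_muley// lte_fin invr_gt0.
  by rewrite /= gt0_muley ?lte_fin.
Qed.

Lemma normalizedE (R : realType) (d : nat)
    (pistar : {finite_measure set (Rd R d) -> \bar R}) A :
  0 < pistar setT ->
  normalized pistar A = pistar A * (fine (pistar setT))^-1%:E.
Proof.
move=> M0; rewrite /normalized /= /mnormalize gt_eqF//=.
by rewrite -[_ == +oo]negbK -ltey ltey_eq fin_num_measure.
Qed.

Lemma dominates_normalized (R : realType) (d : nat)
    (pistar : {finite_measure set (Rd R d) -> \bar R})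
    (eta : probability (Rd R d) R) :
  0 < pistar setT -> normalized pistar `<< eta -> pistar `<< eta.
Proof.
move=> M0 /null_content_dominatesP neta; apply/null_content_dominatesP => A mA A0.
have := neta A mA A0; rewrite normalizedE// => /eqP.
rewrite mule_eq0 => /orP[/eqP//|]; rewrite eqe invr_eq0 gt_eqF//.
by rewrite fine_gt0// M0/= ltey_eq fin_num_measure.
Qed.

Lemma lne_le_H_bound (R : realType) (d : nat)
    (pistar : {finite_measure set (Rd R d) -> \bar R})
    (xi eta : probability (Rd R d) R) (f : Rd R d -> R) :
  0 < pistar setT -> normalized pistar `<< xi -> normalized pistar `<< eta ->
  measurable_fun setT f -> (forall x, 0 <= f x)%R ->
  (forall A, measurable A ->
    normalized pistar A = \int[xi]_(x in A) (f x)%:E) ->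
  ae_eq xi setT (density (normalized pistar) xi) (EFin \o f) ->
  1 <= \int[xi]_x (f x ^+ 2)%:E ->
  lne (\int[xi]_x (f x ^+ 2)%:E) <= H_bound 2 pistar xi eta.
Proof.
move=> M0 pixi pieta mf f0 pif fE S1.
rewrite /H_bound /CUBO (renyi2E pixi mf f0 pif fE).
have := ELBO_le M0 (dominates_normalized M0 pieta).
have Mfin : pistar setT \is a fin_num by rewrite fin_num_measure.
rewrite -(fineK Mfin) lne_EFin; last by rewrite fine_gt0// M0/= ltey_eq Mfin.
by move=> HE; apply: lne_le_bound HE; rewrite lne_ge0.
Qed.

(** * Transport bounds *)

Lemma measurable_dist2_powR (R : realType) (d : nat) (p : R) (y : Rd R d) :
  measurable_fun [set: Rd R d] (fun x => dist2 x y `^ p)%R.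
Proof.
apply: (measurableT_comp (measurable_powR p)).
have mxy : measurable_fun [set: Rd R d] (fun x => (x, y) : Rd R d * Rd R d).
  exact: measurable_fun_pair.
exact: (measurableT_comp (@measurable_dist2 R d) mxy).
Qed.

(** Uses the maximal coupling with cost [dist2 ^ p] and [g x = 2 ^ (p - 1) * dist2 x y ^ p]. The
    centre [y] stays free, for the infima in the moment constants. *)
Lemma wasserstein_le (R : realType) (d : nat) (p : R)
    (xi pi : probability (Rd R d) R) (f : Rd R d -> R) (y : Rd R d) :
  (1 <= p)%R -> measurable_fun setT f -> (forall x, 0 <= f x)%R ->
  (forall A, measurable A -> pi A = \int[xi]_(x in A) (f x)%:E) ->
  wasserstein p xi pi <=
    ((2 `^ (p - 1))%:E * \int[xi]_x (dist2 x y `^ p * `|f x - 1|)%:E) `^ p^-1.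
Proof.
move=> p1 mf f0 pif.
have p0 : (0 < p)%R by rewrite (lt_le_trans ltr01).
have f1 : \int[xi]_x (f x)%:E = 1 by rewrite -pif// probability_setT.
have [gamma [gammaE cost]] := exists_maximal_coupling mf f0 f1.
have mg := measurable_dist2_powR p y.
have mf1 : measurable_fun setT (fun x => dist2 x y `^ p * `|f x - 1|)%R.
  apply: measurable_funM => //; apply: measurableT_comp => //.
  exact: measurable_funB.
apply: (@le_trans _ _ ((\int[gamma]_z ((dist2 z.1 z.2) `^ p)%:E) `^ p^-1)).
  apply: ereal_inf_lbound; exists gamma => // A mA.
  by have [-> ->] := gammaE A mA; rewrite pif.
apply: gt0_ler_poweR; rewrite ?invr_ge0 ?(ltW p0)//.
- rewrite in_itv/= leey andbT; apply: integral_ge0 => z _.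
  by rewrite lee_fin powR_ge0.
- rewrite in_itv/= leey andbT mule_ge0 ?lee_fin ?powR_ge0//.
  by apply: integral_ge0 => z _; rewrite lee_fin mulr_ge0// powR_ge0.
rewrite -ge0_integralZl_EFin_fun ?powR_ge0//; last first.
  by move=> x; rewrite mulr_ge0// powR_ge0.
under [leRHS]eq_integral do rewrite mulrA.
apply: cost.
- exact: (measurableT_comp (measurable_powR p) (@measurable_dist2 R d)).
- exact: measurable_funM.
- by move=> z; exact: powR_ge0.
- by move=> x; rewrite mulr_ge0// powR_ge0.
- by move=> x; rewrite dist2xx powR0// gt_eqF.
- by move=> x z; rewrite -mulrDr; exact: powR_dist2_le.
Qed.

(* A vanishing infimum is attained: the double integral of [dist2 x y `^ r]
   against [xi] is then zero, so [xi] is a Dirac mass. *)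
Lemma exists_integral_dist2_eq0 (R : realType) (d : nat) (r : R)
    (xi : probability (Rd R d) R) : (1 <= r)%R ->
  (forall e : R, (0 < e)%R -> exists y : Rd R d,
     \int[xi]_x (dist2 x y `^ r)%:E <= e%:E) ->
  exists y : Rd R d, \int[xi]_x (dist2 x y `^ r)%:E = 0.
Proof.
move=> r1; have [F FE] : exists F, forall y,
    \int[xi]_x (dist2 x y `^ r)%:E = F y by eexists.
move=> small.
have F0 y : 0 <= F y.
  by rewrite -FE; apply: integral_ge0 => x _; rewrite lee_fin powR_ge0.
have mc : measurable_fun [set: Rd R d * Rd R d]
    (fun z : Rd R d * Rd R d => ((dist2 z.1 z.2) `^ r)%:E).
  apply/measurable_EFinP.
  exact: (measurableT_comp (measurable_powR r) (@measurable_dist2 R d)).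
have mF : measurable_fun setT F.
  have -> : F = fubini_G xi (fun z : Rd R d * Rd R d => (dist2 z.1 z.2 `^ r)%:E).
    by apply/funext => y; rewrite -FE.
  apply: (@measurable_fun_fubini_tonelli_G _ _ _ _ _ xi _ mc).
  by move=> z; rewrite lee_fin powR_ge0.
have c0 : (0 <= 2 `^ (r - 1) :> R)%R by exact: powR_ge0.
have F_le t y : F y <= (2 `^ (r - 1))%:E * (F t + (dist2 y t `^ r)%:E).
  have -> : F t + (dist2 y t `^ r)%:E =
      \int[xi]_x (dist2 x t `^ r + dist2 y t `^ r)%:E.
    rewrite ge0_integralD_EFin; first by rewrite probability_integral_cst FE.
    - exact: measurable_dist2_powR.
    - exact: measurable_cst.
    - by move=> ?; exact: powR_ge0.
    - by move=> ?; exact: powR_ge0.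
  rewrite -FE -ge0_integralZl_EFin_fun//; last 2 first.
  - by apply: measurable_funD => //; exact: measurable_dist2_powR.
  - by move=> x; rewrite addr_ge0// powR_ge0.
  apply: ge0_le_integral_EFin.
  - exact: measurable_dist2_powR.
  - apply: measurable_funM => //; apply: measurable_funD => //.
    exact: measurable_dist2_powR.
  - by move=> x; exact: powR_ge0.
  - by move=> x; exact: powR_dist2_le.
have intF t : \int[xi]_y F y <= (2 `^ (r - 1))%:E * (F t + F t).
  apply: (@le_trans _ _
      (\int[xi]_y ((2 `^ (r - 1))%:E * (F t + (dist2 y t `^ r)%:E)))).
    apply: ge0_le_integral.
    - exact: measurableT.
    - by move=> y _; exact: F0.
    - exact: mF.
    - apply: measurable_funeM; apply: emeasurable_funD.
        exact: measurable_cst.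
      by apply/measurable_EFinP; exact: measurable_dist2_powR.
    - by move=> y _; exact: F_le.
  have md : measurable_fun setT (fun y : Rd R d => (dist2 y t `^ r)%:E).
    by apply/measurable_EFinP; exact: measurable_dist2_powR.
  rewrite ge0_integralZl_EFin//; last 2 first.
  - by move=> y _; rewrite adde_ge0// lee_fin powR_ge0.
  - exact: emeasurable_funD.
  rewrite ge0_integralD//; last by move=> y _; rewrite lee_fin powR_ge0.
  by rewrite integral_cst// [X in _ * X + _](probability_setT xi) mule1 FE.
have iF : \int[xi]_y F y = 0.
  apply/eqP; rewrite eq_le integral_ge0// andbT.
  apply/lee_addgt0Pr => e e0; rewrite add0e.
  have k0 : (0 < 2 `^ (r - 1) * 2 :> R)%R by rewrite mulr_gt0// powR_gt0.
  (* Chosen so that the bound [2 ^ (r - 1) * (F t + F t)] of [intF] is at most [e]. *)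
  have [t Ft] := small (e / (2 `^ (r - 1) * 2))%R (divr_gt0 e0 k0).
  rewrite FE in Ft; apply: (le_trans (intF t)).
  apply: (@le_trans _ _ ((2 `^ (r - 1))%:E *
     ((e / (2 `^ (r - 1) * 2))%:E + (e / (2 `^ (r - 1) * 2))%:E))).
    by apply: lee_wpmul2l => //; exact: leeD.
  rewrite -EFinD -EFinM lee_fin le_eqVlt; apply/orP; left; apply/eqP.
  by field; rewrite gt_eqF// powR_gt0.
have : ae_eq xi setT F (cst 0).
  apply/ae_eq_integral_abs => //; rewrite -[RHS]iF.
  by apply: eq_integral => y _; rewrite gee0_abs.
(* If [F] vanished nowhere, the null set [N] would be the whole space, which has mass one. *)
move=> [N [mN N0 subN]]; apply: contrapT => nex.
have NT : N = setT.
  apply/seteqP; split => // y _; apply: subN => /= Fy.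
  by apply: nex; exists y; rewrite FE; exact: Fy.
have N1 : xi N = 1 by rewrite NT; exact: probability_setT.
have : 1 = 0 :> \bar R by rewrite -N1.
by move/eqP; rewrite onee_eq0.
Qed.

(** At a centre with zero moment the distance vanishes almost everywhere, hence so does the cost,
    whatever [f] is. The order [r] is [2 * p] for the first bound and [p] for the second. *)
Lemma wasserstein_le0 (R : realType) (d : nat) (p r : R)
    (xi pi : probability (Rd R d) R) (f : Rd R d -> R) :
  (1 <= p)%R -> (1 <= r)%R -> measurable_fun setT f -> (forall x, 0 <= f x)%R ->
  (forall A, measurable A -> pi A = \int[xi]_(x in A) (f x)%:E) ->
  (forall e : R, (0 < e)%R -> exists y : Rd R d,
     \int[xi]_x (dist2 x y `^ r)%:E <= e%:E) ->
  wasserstein p xi pi <= 0.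
Proof.
move=> p1 r1 mf f0 pif /(exists_integral_dist2_eq0 r1)[y y0].
apply: (le_trans (wasserstein_le y p1 mf f0 pif)).
have md : measurable_fun setT (fun x : Rd R d => dist2 x y).
  have := measurable_dist2_powR 1 y.
  by under eq_fun do rewrite powRr1 ?dist2_ge0//.
rewrite (ae_integral_powR0 (r := r))//.
- by rewrite mule0 poweR0r// invr_eq0 gt_eqF// (lt_le_trans ltr01).
- by apply: measurableT_comp => //; exact: measurable_funB.
- by move=> x; exact: dist2_ge0.
- exact: lt_le_trans r1.
- exact: lt_le_trans p1.
Qed.

(* The last hypothesis covers [x = +oo], where the bound reads [w <= 0 * +oo],
   that is [w <= 0]. *)
Lemma le_mul_ereal_inf (R : realType) (A : set (\bar R)) (w x : \bar R) :
  A !=set0 -> (forall a, A a -> 0 <= a) -> 0 <= x ->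
  (forall a, A a -> w <= 2%:E * a * x) -> (ereal_inf A = 0 -> w <= 0) ->
  w <= 2%:E * ereal_inf A * x.
Proof.
move=> [a0 Aa0] A0 x0 wA winf.
have infA0 : 0 <= ereal_inf A by apply/ereal_infP.
case: x x0 wA => [x| |]//; last first.
  move=> _ wA; have [i0|i0] := eqVneq (ereal_inf A) 0.
    by rewrite i0 mule0 mul0e winf.
  rewrite gt0_muley ?leey// mule_gt0 ?lte_fin//.
  by rewrite lt_neqAle eq_sym i0.
rewrite lee_fin le_eqVlt => /predU1P[<- wA|x0 wA].
  by have := wA _ Aa0; rewrite !mule0.
have tx0 : (0 < 2 * x)%R by rewrite mulr_gt0.
rewrite muleAC -EFinM -ereal_inf_pZl//; apply/ereal_infP => _ [a Aa <-].
by have := wA a Aa; rewrite muleAC.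
Qed.

Lemma wasserstein_le_C_PI (R : realType) (d : nat) (p : R)
    (xi pi : probability (Rd R d) R) (f : Rd R d -> R) (H : \bar R) :
  (1 <= p)%R -> measurable_fun setT f -> (forall x, 0 <= f x)%R ->
  (forall A, measurable A -> pi A = \int[xi]_(x in A) (f x)%:E) ->
  1 <= \int[xi]_x (f x ^+ 2)%:E ->
  lne (\int[xi]_x (f x ^+ 2)%:E) <= H ->
  wasserstein p xi pi <= C_PI (2 * p) xi * (expeR H - 1) `^ (2 * p)^-1.
Proof.
move=> p1 mf f0 pif S1 SH.
have p0 : (0 < p)%R by rewrite (lt_le_trans ltr01).
have pp0 : (0 < 2 * p)%R by rewrite mulr_gt0.
have f1 : \int[xi]_x (f x)%:E = 1 by rewrite -pif// probability_setT.
set S := \int[xi]_x _ in S1 SH.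
have S10 : 0 <= S - 1 by rewrite sube_ge0.
have SeH : S - 1 <= expeR H - 1.
  rewrite leeB// -[S]lneK ?lee_expeR//.
  by rewrite in_itv/= leey andbT (le_trans _ S1).
apply: le_mul_ereal_inf.
- by exists ((\int[xi]_x ((dist2 x 0%R) `^ (2 * p))%:E) `^ (2 * p)^-1); exists 0%R.
- by move=> _ [y _ <-]; exact: poweR_ge0.
- exact: poweR_ge0.
- move=> _ [y _ <-]; set G := \int[xi]_x _.
  have G0 : 0 <= G by apply: integral_ge0 => x _; rewrite lee_fin powR_ge0.
  have GE : \int[xi]_x ((dist2 x y `^ p) ^+ 2)%:E = G.
    apply: eq_integral => x _; congr EFin.
    by rewrite -powR_mulrn ?powR_ge0// -powRrM mulrC.
  have Ile := integral_mul_abs_sub1_le (measurable_dist2_powR p y) mf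
    (fun x => powR_ge0 _ _) f0 f1.
  rewrite GE -/S in Ile.
  apply: (le_trans (wasserstein_le y p1 mf f0 pif)).
  apply: (@le_trans _ _ (((2 `^ (p - 1))%:E *
      (G `^ 2^-1 * (S - 1) `^ 2^-1)) `^ p^-1)).
    apply: gt0_ler_poweR; rewrite ?invr_ge0 ?(ltW p0)//.
    + rewrite in_itv/= leey andbT mule_ge0 ?lee_fin ?powR_ge0//.
      by apply: integral_ge0 => z _; rewrite lee_fin mulr_ge0// powR_ge0.
    + by rewrite in_itv/= leey andbT !mule_ge0 ?lee_fin ?powR_ge0 ?poweR_ge0.
    + by apply: lee_wpmul2l => //; rewrite lee_fin powR_ge0.
  rewrite !poweRM ?mule_ge0 ?poweR_ge0 ?lee_fin ?powR_ge0//.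
  rewrite -!poweRrM -invfM -muleA; apply: lee_pmul.
  + exact: poweR_ge0.
  + by rewrite mule_ge0 ?poweR_ge0.
  (* The factor 2 of [C_PI] comes from [2 ^ ((p - 1) / p) <= 2]. *)
  + rewrite poweR_EFin lee_fin -powRrM -[leRHS]powRr1// ler_powR ?ler1n//.
    by rewrite ler_pdivrMr// mul1r gerBl.
  + apply: lee_wpmul2l; first exact: poweR_ge0.
    apply: gt0_ler_poweR; rewrite ?invr_ge0 ?(ltW pp0)// in_itv/= leey andbT//.
    exact: le_trans S10 SeH.
(* A zero infimum yields centres with arbitrarily small moment of order [2 * p]. *)
- move=> inf0; apply: (wasserstein_le0 (r := 2 * p) p1 _ mf f0 pif); first lra.
  move=> e e0.
  have : ereal_inf [set (\int[xi]_x ((dist2 x x0) `^ (2 * p))%:E) `^ (2 * p)^-1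
      | x0 in [set: Rd R d]] < (e `^ (2 * p)^-1)%:E.
    by rewrite inf0 lte_fin powR_gt0.
  move=> /ereal_inf_lt[_ [y _ <-] ye]; exists y.
  rewrite leNgt; apply/negP => /ltW ey; move: ye; rewrite ltNge => /negP; apply.
  rewrite -poweR_EFin; apply: gt0_ler_poweR => //.
  + by rewrite invr_ge0 ltW.
  + by rewrite in_itv/= leey andbT lee_fin ltW.
  + by rewrite in_itv/= leey andbT (le_trans _ ey)// lee_fin ltW.
Qed.

(** Since [sqrt (2 K) = 2 sqrt (K / 2)], the left-hand base is [2 ^ p] times [eps^-1 (3/2 + L)]
    times [K + sqrt (K / 2)]; the root of order [p] is subadditive on the last factor. *)
Lemma powR_C_EI_le (R : realType) (p eps L K : R) :
  (1 <= p -> 0 < eps -> 0 <= L -> 0 <= K ->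
   (2 `^ (p - 1) * (eps^-1 * ((3 / 2 + L) * (Num.sqrt (2 * K) + 2 * K)))) `^ p^-1
   <= 2 * (eps^-1 * (3 / 2 + L)) `^ p^-1 *
      (K `^ p^-1 + (K * 2^-1) `^ (2 * p)^-1))%R.
Proof.
move=> p1 e0 L0 K0; have p0 : (0 < p)%R by rewrite (lt_le_trans ltr01).
have a0 : (0 <= eps^-1 * (3 / 2 + L))%R.
  by rewrite mulr_ge0 ?invr_ge0 ?(ltW e0)//; lra.
have s0 : (0 <= (K * 2^-1) `^ 2^-1)%R by exact: powR_ge0.
have -> : (2 `^ (p - 1) *
    (eps^-1 * ((3 / 2 + L) * (Num.sqrt (2 * K) + 2 * K))) =
    2 `^ p * ((eps^-1 * (3 / 2 + L)) * (K + (K * 2^-1) `^ 2^-1)))%R.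
  have -> : (Num.sqrt (2 * K) = 2 * (K * 2^-1) `^ 2^-1)%R.
    rewrite powR12_sqrt ?mulr_ge0//.
    have -> : (2 * K = 2 ^+ 2 * (K * 2^-1))%R by field.
    by rewrite sqrtrM ?sqr_ge0// sqrtr_sqr ger0_norm.
  rewrite powRB ?pnatr_eq0 ?implybT// powRr1//.
  by field; rewrite gt_eqF.
have Ks0 : (0 <= K + (K * 2^-1) `^ 2^-1)%R by exact: addr_ge0.
have as0 : (0 <= eps^-1 * (3 / 2 + L) * (K + (K * 2^-1) `^ 2^-1))%R.
  exact: mulr_ge0.
set B := (K + _)%R in Ks0 as0 *.
rewrite powRM ?powR_ge0// (powRM _ a0 Ks0) -powRrM mulfV ?gt_eqF// powRr1//.
rewrite [leLHS]mulrA ler_wpM2l ?mulr_ge0 ?powR_ge0//.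
rewrite (le_trans (powR_subadd _ _ _ _)) ?invr_gt0 ?invf_le1//.
by rewrite -powRrM invfM.
Qed.

Lemma wasserstein_le_C_EI (R : realType) (d : nat) (p : R)
    (xi pi : probability (Rd R d) R) (f : Rd R d -> R) (H : \bar R) :
  (1 <= p)%R -> measurable_fun setT f -> (forall x, 0 <= f x)%R ->
  (forall A, measurable A -> pi A = \int[xi]_(x in A) (f x)%:E) ->
  1 <= \int[xi]_x (f x ^+ 2)%:E ->
  lne (\int[xi]_x (f x ^+ 2)%:E) <= H ->
  wasserstein p xi pi <= C_EI p xi *
    (H `^ p^-1 + (H * (2^-1)%:E) `^ (2 * p)^-1).
Proof.
move=> p1 mf f0 pif S1 SH.
have p0 : (0 < p)%R by rewrite (lt_le_trans ltr01).
have ip0 : (0 <= p^-1)%R by rewrite invr_ge0 ltW.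
have pp0 : (0 < 2 * p)%R by rewrite mulr_gt0.
have f1 : \int[xi]_x (f x)%:E = 1 by rewrite -pif// probability_setT.
set S := \int[xi]_x _ in S1 SH.
have H0 : 0 <= H by rewrite (le_trans _ SH)// lne_ge0.
have mg (y : Rd R d) :
    measurable_fun setT (fun x : Rd R d => dist2 x y `^ p)%R.
  exact: measurable_dist2_powR.
have mI (y : Rd R d) : measurable_fun setT (fun x : Rd R d => dist2 x y `^ p * `|f x - 1|)%R.
  apply: measurable_funM => //; apply: measurableT_comp => //.
  exact: measurable_funB.
have I0 y x : (0 <= dist2 x y `^ p * `|f x - 1|)%R.
  by rewrite mulr_ge0// powR_ge0.
have x0 : 0 <= H `^ p^-1 + (H * (2^-1)%:E) `^ (2 * p)^-1.
  by rewrite adde_ge0 ?poweR_ge0.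
(* The infimum runs over all [eps], so infinite exponential moments have to be handled too. *)
have momentP (y : Rd R d) (eps : R) : (0 < eps)%R ->
    \int[xi]_x (expR (eps * dist2 x y `^ p))%:E = +oo \/
    exists2 L : R, (0 <= L)%R &
      \int[xi]_x (expR (eps * dist2 x y `^ p))%:E = (expR L)%:E.
  move=> e0; set E := \int[xi]_x _.
  have mh : measurable_fun setT (fun x => eps * dist2 x y `^ p)%R.
    exact: measurable_funM.
  have h0 x : (0 <= eps * dist2 x y `^ p)%R by rewrite mulr_ge0 ?powR_ge0// ltW.
  have E1 : 1 <= E.
    rewrite -(probability_integral_cst xi); apply: ge0_le_integral_EFin => //.
      exact: measurableT_comp.
    by move=> x; rewrite -expR0 ler_expR.
  have [->|Eoo] := eqVneq E +oo; [by left|right].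
  have Efin : E \is a fin_num.
    by rewrite ge0_fin_numE ?ltey// (le_trans _ E1).
  have E1' : (1 <= fine E)%R by rewrite -lee_fin fineK.
  exists (ln (fine E)); first by rewrite ln_ge0.
  by rewrite lnK ?fineK// posrE; lra.
apply: le_mul_ereal_inf => //.
- exists (((1^-1)%:E * ((3 / 2)%:E +
      lne (\int[xi]_x (expR (1 * (dist2 x 0%R) `^ p))%:E))) `^ p^-1).
  exists 0%R; first by [].
  by exists 1%R; first exact: ltr01.
- by move=> _ [y _ [eps _ <-]]; exact: poweR_ge0.
- move=> _ [y _ [eps /= e0 <-]].
  apply: (le_trans (wasserstein_le y p1 mf f0 pif)).
  have ie0 : (0 < eps^-1)%R by rewrite invr_gt0.
  (* For [H = 0] the bound is zero even when the exponential moment is infinite. Then [S = 1], and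
     Cauchy-Schwarz with [0 * +oo = 0] makes the cost vanish. *)
  have [H00|Hn0] := eqVneq H 0.
    have SE : S = 1.
      apply/eqP; rewrite -lne_eq0 eq_le -{1}H00 SH/=.
      by rewrite lne_ge0.
    have Ile := integral_mul_abs_sub1_le (mg y) mf (fun x => powR_ge0 _ _) f0 f1.
    rewrite -/S SE subee// poweR0r ?invr_eq0// mule0 in Ile.
    have -> : \int[xi]_x (dist2 x y `^ p * `|f x - 1|)%:E = 0.
      apply/eqP; rewrite eq_le Ile/= integral_ge0// => x _.
      by rewrite lee_fin.
    rewrite mule0 poweR0r ?invr_eq0 ?gt_eqF//.
    by rewrite !mule_ge0 ?poweR_ge0.
  have Hp : 0 < H by rewrite lt_neqAle eq_sym Hn0.
  have [->|[L L0 EL]] := momentP y eps e0.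
    rewrite [lne +oo]/= addey// gt0_muley ?lte_fin// poweRyr ?invr_eq0 ?gt_eqF//.
    rewrite gt0_muley ?lte_fin// gt0_mulye ?leey//.
    by rewrite (lt_le_trans (poweR_gt0 p^-1 Hp))// leeDl ?poweR_ge0.
  rewrite EL lne_EFin ?expR_gt0// expRK -EFinD -EFinM.
  (* For [H = +oo] the bound is infinite, because [3 / 2 + L] is positive. *)
  move: H H0 SH x0 Hn0 Hp => [K| |]// H0 SH x0 Hn0 Hp; last first.
    rewrite poweRyr ?invr_eq0 ?gt_eqF// addye; last first.
      by rewrite gt_eqF// (lt_le_trans _ (poweR_ge0 _ _))// ltNyr.
    rewrite gt0_muley ?leey// ?poweR_EFin -?EFinM lte_fin mulr_gt0//.
    by rewrite powR_gt0// mulr_gt0//; lra.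
  have mh : measurable_fun setT (fun x => eps * dist2 x y `^ p)%R.
    exact: measurable_funM.
  have h0 x : (0 <= eps * dist2 x y `^ p)%R by rewrite mulr_ge0 ?powR_ge0// ltW.
  have SK : S <= (expR K)%:E.
    rewrite -[S]lneK ?in_itv/= ?leey ?andbT ?(le_trans _ S1)//.
    by rewrite -[(expR K)%:E]/(expeR K%:E) lee_expeR.
  have := integral_expR_mul_abs_sub1_le mh mf h0 f0 f1 EL S1 SK.
  under eq_integral do rewrite -mulrA.
  rewrite ge0_integralZl_EFin_fun ?(ltW e0)//.
  rewrite lee_fin in H0.
  set I := \int[xi]_x _; rewrite -lee_pdivlMl// -EFinM => IB.
  apply: (@le_trans _ _ ((2 `^ (p - 1) *
      (eps^-1 * ((3 / 2 + L) * (Num.sqrt (2 * K) + 2 * K))))%:E `^ p^-1)).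
    have I00 : 0 <= I by apply: integral_ge0 => x _; rewrite lee_fin.
    have c0 : 0 <= (2 `^ (p - 1))%:E :> \bar R by rewrite lee_fin powR_ge0.
    rewrite [X in _ <= X `^ _]EFinM; apply: gt0_ler_poweR => //.
    + by rewrite in_itv/= leey andbT mule_ge0.
    + by rewrite in_itv/= leey andbT mule_ge0// (le_trans I00).
    + exact: lee_wpmul2l.
  by have := powR_C_EI_le p1 e0 L0 H0; rewrite -lee_fin; apply.
- move=> inf0; apply: (wasserstein_le0 (r := p) p1 p1 mf f0 pif) => e e0.
  have : ereal_inf [set ((eps^-1)%:E * ((3 / 2)%:E +
      lne (\int[xi]_x (expR (eps * (dist2 x x0) `^ p))%:E))) `^ p^-1
      | x0 in [set: Rd R d] & eps in [set eps : R | (0 < eps)%R]]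
      < (e `^ p^-1)%:E.
    by rewrite inf0 lte_fin powR_gt0.
  move=> /ereal_inf_lt[_ [y _ [eps /= eps0 <-]] ye]; exists y.
  have ie0 : (0 < eps^-1)%R by rewrite invr_gt0.
  have [Eoo|[L L0 EL]] := momentP y eps eps0.
    move: ye; rewrite Eoo [lne +oo]/= addey// gt0_muley ?lte_fin//.
    by rewrite poweRyr ?invr_eq0 ?gt_eqF.
  move: ye; rewrite EL lne_EFin ?expR_gt0// expRK -EFinD -EFinM poweR_EFin.
  rewrite lte_fin => ye.
  have Le : (eps^-1 * L <= e)%R.
    rewrite leNgt; apply/negP => eL; move: ye; rewrite ltNge => /negP; apply.
    rewrite ge0_ler_powR ?nnegrE ?(ltW e0)// ?mulr_ge0 ?(ltW ie0)//; first lra.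
    rewrite (le_trans (ltW eL))// ler_wpM2l ?(ltW ie0)//; lra.
  have mh : measurable_fun setT (fun x => eps * dist2 x y `^ p)%R.
    exact: measurable_funM.
  have h0 x : (0 <= eps * dist2 x y `^ p)%R by rewrite mulr_ge0 ?powR_ge0// ltW.
  have := integral_le_expR mh h0 EL.
  rewrite ge0_integralZl_EFin_fun ?(ltW eps0)//; last by move=> x; exact: powR_ge0.
  rewrite -lee_pdivlMl// -EFinM => /le_trans; apply.
  by rewrite lee_fin.
Qed.

Theorem theorem4p6 (R : realType) (d : nat)
    (pistar : {finite_measure set (Rd R d) -> \bar R})
    (M_gt0 : 0 < pistar setT)
    (p : R) (p_ge1 : (1 <= p)%R)
    (pihat eta : probability (Rd R d) R)
    (pi_pihat : normalized pistar `<< pihat)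
    (pi_eta : normalized pistar `<< eta) :
  wasserstein p pihat (normalized pistar) <=
    C_PI (2 * p) pihat *
      (expeR (H_bound 2 pistar pihat eta) - 1) `^ (2 * p)^-1 /\
  wasserstein p pihat (normalized pistar) <=
    C_EI p pihat *
      ((H_bound 2 pistar pihat eta) `^ p^-1 +
       (H_bound 2 pistar pihat eta * (2^-1)%:E) `^ (2 * p)^-1).
Proof.
have [f [mf f0 pif fE]] := exists_density pi_pihat.
have f1 : \int[pihat]_x (f x)%:E = 1 by rewrite -pif//; exact: probability_setT.
have S1 : 1 <= \int[pihat]_x (f x ^+ 2)%:E.
  (* The difference is the integral of [(f - 1) ^ 2]. *)
  rewrite -sube_ge0//.
  rewrite -integral_sqr_sub1//; apply: integral_ge0 => x _.
  by rewrite lee_fin sqr_ge0.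
have SH := lne_le_H_bound M_gt0 pi_pihat pi_eta mf f0 pif fE S1.
split; first exact: (wasserstein_le_C_PI p_ge1 mf f0 pif S1 SH).
exact: (wasserstein_le_C_EI p_ge1 mf f0 pif S1 SH).
Qed.
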